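(* Let $K=\{z\in\mathbb C:|z|^2=1\}$ be the unit circle. Reversion in $K$ through a point $p\in\mathbb C$ corresponds to the Möbius transformation $$\hat P:\ z\ \longrightarrow\ z'=\begin{pmatrix}1&-p\\ \bar p&-1\end{pmatrix}\cdot z=\frac{z-p}{\bar p z-1}.$$
   Context: The plane is identified with $\mathbb C$, and a matrix acts on complex numbers by $\begin{pmatrix}a&b\\ c&d\end{pmatrix}\cdot z=\frac{az+b}{cz+d}$. Given a circle $K$ in the plane and a point $P\notin K$, the reversion through $P$ is the map $\mathbf P:K\to K$, $A\mapsto\mathbf P(A)$, such that the points $A,P,\mathbf P(A)$ are collinear and $\mathbf P(A)\neq A$. If $P\in K$, then $\mathbf P(A)=P$ for every $A\in K$. *)

(* Defs.v *)
From mathcomp Require Import all_boot all_order all_algebra.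
From mathcomp Require Import boolp classical_sets reals.
From mathcomp Require Import complex.

Set Implicit Arguments.
Unset Strict Implicit.
Unset Printing Implicit Defensive.

Import Order.TTheory GRing.Theory Num.Theory.

Local Open Scope classical_set_scope.
Local Open Scope ring_scope.
Local Open Scope complex_scope.

Definition unit_circle (R : realType) : set R[i] := [set z | `|z| ^+ 2 = 1].

Arguments unit_circle R : clear implicits.

Definition collinear (R : realType) (a b c : R[i]) : Prop :=
  exists (q v : R[i]) (s t u : R),
    [/\ v != 0, a = q + s%:C * v, b = q + t%:C * v & c = q + u%:C * v].

(* [K] is intended to be a circle. If the line through [A] and [P] is tangent
   to [K] at [A], no point of [K] other than [A] is collinear with [A] and [P];
   requiring [f A <> A] only when such a point exists gives [f A = A] there. *)
Definition is_reversion (R : realType) (K : set R[i]) (P : R[i])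
    (f : K -> K) : Prop :=
  (K P -> forall A : K, val (f A) = P) /\
  (~ K P -> forall A : K,
     collinear (val A) P (val (f A)) /\
     ((exists B : K, B <> A /\ collinear (val A) P (val B)) -> f A <> A)).

Arguments is_reversion {R} K P f.

Definition mx2 (F : nzRingType) (a b c d : F) : 'M[F]_2 :=
  \matrix_(i, j) if i == 0 then (if j == 0 then a else b)
                 else (if j == 0 then c else d).

Definition mobius_den (F : fieldType) (M : 'M[F]_2) (z : F) : F :=
  M 1 0 * z + M 1 1.

(* Only meaningful where [mobius_den M z != 0], since [x / 0 = 0]. *)
Definition mobius (F : fieldType) (M : 'M[F]_2) (z : F) : F :=
  (M 0 0 * z + M 0 1) / mobius_den M z.

(* Main.v *)
(* For [z != p], the point [c] lies on the line through [z] and [p] iff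
   [(c - z) * (p - z)^*] is real.  On the unit circle conjugation is inversion,
   so for [c] and [z] there, multiplying this condition by [c * z] factors it as
   [(c - z) * (c * (p^* * z - 1) - (z - p)) = 0]; the second factor gives the
   Moebius image of [z], which equals [z] exactly in the case of tangency. *)

Require Import Defs.
From mathcomp Require Import all_boot all_order all_algebra.
From mathcomp Require Import boolp classical_sets reals.
From mathcomp Require Import complex ring.

Set Implicit Arguments.
Unset Strict Implicit.
Unset Printing Implicit Defensive.

Import Order.TTheory GRing.Theory Num.Theory.

Local Open Scope classical_set_scope.
Local Open Scope ring_scope.
Local Open Scope complex_scope.

Section ConjugateInverse.
Variable C : numClosedFieldType.
Implicit Types p z c : C.

Lemma unit_normP z : `|z| ^+ 2 = 1 <-> z * z^* = 1.
Proof. by rewrite normCK. Qed.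

Lemma unit_norm_neq0 z : z * z^* = 1 -> z != 0.
Proof.
move=> hz; apply/eqP => z0; move/eqP: hz.
by rewrite z0 mul0r eq_sym oner_eq0.
Qed.

(** A zero denominator means [p^* * z = z^* * z]; cancelling [z] and conjugating gives [z = p]. *)
Lemma reversion_den_neq0 p z : z * z^* = 1 -> z != p -> p^* * z - 1 != 0.
Proof.
move=> hz; apply: contra_neq => /eqP.
rewrite subr_eq0 -hz mulrC => /eqP /(mulfI (unit_norm_neq0 hz)).
by move/(inv_inj conjCK).
Qed.

Lemma reversion_norm p z : z * z^* = 1 -> z != p ->
  let w := (z - p) / (p^* * z - 1) in w * w^* = 1.
Proof.
move=> hz zp w.
have d0 := reversion_den_neq0 hz zp.
rewrite /w fmorph_div mulf_div !rmorphB rmorphM /= conjCK rmorph1.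
have <- : (z - p) * (z^* - p^*) = (p^* * z - 1) * (p * z^* - 1).
  have -> : (p^* * z - 1) * (p * z^* - 1)
          = (z - p) * (z^* - p^*) + (1 - z * z^*) * (1 - p * p^*) by ring.
  by rewrite hz subrr mul0r addr0.
by rewrite divff // mulf_neq0 // -?rmorphB ?conjC_eq0 subr_eq0.
Qed.

(** For [p] on the circle [p * (p^* * z - 1) = z - p], so the fraction agrees with the convention
    that reversion is then constant. *)
Lemma reversion_fixed p z : p * p^* = 1 -> z * z^* = 1 -> z != p ->
  (z - p) / (p^* * z - 1) = p.
Proof.
move=> hp hz zp; apply: (mulIf (reversion_den_neq0 hz zp)).
by rewrite divfK ?reversion_den_neq0 // mulrBr mulrA hp mul1r mulr1.
Qed.

Lemma chord_realP p z c : z * z^* = 1 -> c * c^* = 1 -> z != p ->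
  (c - z) * (p - z)^* = (c - z)^* * (p - z) <->
  c = z \/ c = (z - p) / (p^* * z - 1).
Proof.
move=> hz hc zp; have d0 := reversion_den_neq0 hz zp.
have cz0 : c * z != 0 by rewrite mulf_neq0 ?unit_norm_neq0.
have key : c * z * ((c - z) * (p - z)^* - (c - z)^* * (p - z))
         = (c - z) * (c * (p^* * z - 1) - (z - p)).
  rewrite !rmorphB.
  (* A polynomial identity with the conjugates as free variables; the correction terms are multiples
     of [z * z^* - 1] and [c * c^* - 1]. *)
  have -> : c * z * ((c - z) * (p^* - z^*) - (c^* - z^*) * (p - z))
    = (c - z) * (c * (p^* * z - 1) - (z - p))
      - c * (c - z) * (z * z^* - 1) - z * (p - z) * (c * c^* - 1)
      + c * (p - z) * (z * z^* - 1) by ring.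
  by rewrite hz hc subrr !mulr0 !subr0 addr0.
split.
  move=> /eqP; rewrite -subr_eq0 => /eqP e0; move: key.
  rewrite e0 mulr0 => /esym/eqP; rewrite mulf_eq0 !subr_eq0.
  by case/orP=> /eqP; [left | move=> <-; right; rewrite mulfK].
move=> h; apply/eqP; rewrite -subr_eq0 -(mulrI_eq0 _ (mulfI cz0)) key.
by case: h => ->; rewrite ?subrr ?mul0r // divfK // subrr mulr0.
Qed.

End ConjugateInverse.

Section Reversion.
Variable R : realType.
Implicit Types (p : R[i]) (A B : unit_circle R).

Lemma conj_realC (s : R) : (s%:C)^*%R = s%:C :> R[i].
Proof. by apply/eqP; rewrite -CrealE complex_real. Qed.

(** The equation says that [(c - a) / (b - a)] is its own conjugate, hence real; this ratio is the
    parameter of [c] on the line from [a] in direction [b - a]. *)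
Lemma collinearP (a b c : R[i]) : a != b ->
  collinear a b c <-> (c - a) * (b - a)^*%R = (c - a)^*%R * (b - a).
Proof.
move=> ab; split.
  move=> [q [v [s [t [u [_ -> -> ->]]]]]].
  by rewrite !(rmorphB, rmorphD, rmorphM) /= !conj_realC; ring.
have ba0 : b - a != 0 by rewrite subr_eq0 eq_sym.
move=> h; set x := (c - a) / (b - a).
have xr : x \is Num.real.
  rewrite CrealE /x fmorph_div /= eqr_div ?conjC_eq0 //.
  by rewrite -h.
exists a, (b - a), 0, 1, (complex.Re x); split=> //.
- by rewrite mul0r addr0.
- by rewrite mul1r addrC subrK.
- by rewrite RRe_real // /x divfK // addrC subrK.
Qed.

Lemma unit_circleP (A : unit_circle R) : val A * (val A)^*%R = 1.
Proof. by apply/unit_normP; case: A => a /= /set_mem. Qed.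

Lemma circle_chordP p A B : val A != p ->
  collinear (val A) p (val B) <->
  B = A \/ val B = (val A - p) / (p^*%R * val A - 1).
Proof.
move=> Ap; rewrite collinearP // chord_realP ?unit_circleP //.
by split=> -[h|h]; [left; apply: val_inj | right | left; rewrite h | right].
Qed.

(** The case split keeps the value on the circle even at [A = p], where the fraction would be
    [0 / 0 = 0]. *)
Definition reversion_image p A : R[i] :=
  if pselect (unit_circle R p) then p else (val A - p) / (p^*%R * val A - 1).

Lemma reversion_imageE p A : val A != p ->
  reversion_image p A = (val A - p) / (p^*%R * val A - 1).
Proof.
rewrite /reversion_image; case: pselect => // Kp Ap.
have hp : p * p^*%R = 1 by apply/unit_normP.
by rewrite reversion_fixed ?unit_circleP.
Qed.

Lemma off_circle_neq p A : ~ unit_circle R p -> val A != p.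
Proof.
by move=> Kp; apply: contra_notN Kp => /eqP <-; apply/unit_normP/unit_circleP.
Qed.

Lemma reversion_image_circle p A : unit_circle R (reversion_image p A).
Proof.
rewrite /reversion_image; case: pselect => // Kp.
have Ap := off_circle_neq A Kp.
by apply/unit_normP/reversion_norm; rewrite ?unit_circleP.
Qed.

(** Prescribing every value of [f] yields existence and uniqueness of the reversion at once. *)
Lemma is_reversionP p (f : unit_circle R -> unit_circle R) :
  is_reversion (unit_circle R) p f <->
  forall A, val (f A) = reversion_image p A.
Proof.
rewrite /is_reversion /reversion_image; case: pselect => Kp /=.
  by split=> [[h _]|h]; [exact: h | split].
split=> [[_ h] A | h].
  have Ap := off_circle_neq A Kp.
  have [/(circle_chordP _ Ap)[fA|//] nfix] := h Kp A.
  have wK : unit_circle R ((val A - p) / (p^*%R * val A - 1)).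
    by apply/unit_normP/reversion_norm; rewrite ?unit_circleP.
  (* Here [f A = A]. Either the fraction [B] equals [A], the tangent case, or [B] is a second point
     of the chord, which forbids [f A = A]. *)
  pose B : unit_circle R := SigSub (mem_set wK).
  have [BA|BA] := pselect (B = A); first by rewrite fA -[in LHS]BA.
  case: nfix => //; exists B; split=> //.
  by apply/circle_chordP => //; right.
split=> // _ A; have Ap := off_circle_neq A Kp; split.
  by apply/(circle_chordP _ Ap); right; exact: h.
(* A second point [B] of the chord must be the fraction, that is [f A], so [f A = A] would give
   [B = A]. *)
move=> [B [BA /(circle_chordP _ Ap)[//|hB]]] fA; apply: BA.
by apply: val_inj; rewrite hB -h fA.
Qed.

End Reversion.

(* The point z = p is excluded: it matters only when p lies on the circle, and
   there the fraction is 0 / 0. *)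
Theorem theorem3p1 (R : realType) (p : R[i]) :
  (exists! f : unit_circle R -> unit_circle R, is_reversion (unit_circle R) p f) /\
  (forall f : unit_circle R -> unit_circle R, is_reversion (unit_circle R) p f ->
   forall z : unit_circle R, val z <> p ->
   [/\ mobius_den (mx2 1 (- p) (Num.conj p) (- 1)) (val z) != 0,
       val (f z) = mobius (mx2 1 (- p) (Num.conj p) (- 1)) (val z) &
       mobius (mx2 1 (- p) (Num.conj p) (- 1)) (val z)
         = (val z - p) / (Num.conj p * val z - 1)]).
Proof.
split.
  exists (fun A => SigSub (mem_set (reversion_image_circle p A))).
  split; first exact/is_reversionP.
  move=> g /is_reversionP hg; apply/funext => A.
  by apply: val_inj; rewrite hg.
move=> f /is_reversionP hf z /eqP zp.
have denE : mobius_den (mx2 1 (- p) (Num.conj p) (- 1)) (val z)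
          = Num.conj p * val z - 1 by rewrite /mobius_den !mxE.
have mobE : mobius (mx2 1 (- p) (Num.conj p) (- 1)) (val z)
          = (val z - p) / (Num.conj p * val z - 1).
  by rewrite /mobius denE !mxE mul1r.
rewrite denE mobE; split=> //.
  exact/reversion_den_neq0/zp/unit_circleP.
by rewrite hf reversion_imageE.
Qed.
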